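(* Let $(k,N)\in\{(2,27),(2,32),(2,36),(2,49),(4,9)\}$. For each integer $n\ge2$, let $\phi_n\in M_{2-k}^\infty(\Gamma_0(N))\cap\mathbb{Z}((q))$ be any form of the shape $\phi_n=q^{-n}+A_n(-1)q^{-1}+\sum_{m\ge1}A_n(m)q^m$ if $k=2$, or $\phi_n=q^{-n}+\sum_{m\ge-1}A_n(m)q^m$ if $k=4$. For each admissible $m$ (namely $m\in\{-1\}\cup\{1,2,3,\dots\}$ if $k=2$, and $m\ge-1$ if $k=4$), let $F_m$ be the unique element of $S_k^\infty(\Gamma_0(N))\cap\mathbb{Z}((q))$ of the form $F_m=-q^{-m}+\sum_{n\ge2}C_m(n)q^n$. Then for all integers $n\ge2$ and all admissible $m$, \[C_m(n)=A_n(m).\]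
   Context: $q=e^{2\pi i z}$. $M_{w}^\infty(\Gamma_0(N))$ is the space of weakly holomorphic modular forms of weight $w$ on $\Gamma_0(N)$ (trivial character), holomorphic on the upper half-plane and at every cusp except possibly $\infty$; $S_w^\infty(\Gamma_0(N))$ is the subspace of those vanishing at every cusp except possibly $\infty$. $\mathbb{Z}((q))$ denotes Laurent series in $q$ with integer coefficients. (Such $\phi_n$ and $F_m$ exist for each of the listed $(k,N)$.) *)

(* Defs.v *)
From Stdlib Require Import Reals ZArith Lra.
From Coquelicot Require Import Coquelicot.
Open Scope R_scope.

Fixpoint Cpown (z : C) (n : nat) : C :=
  match n with O => RtoC 1 | S n' => Cmult z (Cpown z n') end.

Definition Cpowz (z : C) (w : Z) : C :=
  match w with
  | Z0 => RtoC 1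
  | Zpos p => Cpown z (Pos.to_nat p)
  | Zneg p => Cinv (Cpown z (Pos.to_nat p))
  end.

(* qpow j z = q^j = exp(2 pi i j z), j an integer, z = x + i y *)
Definition qpow (j : Z) (z : C) : C :=
  let t := 2 * PI * IZR j in
  (exp (- t * Im z) * cos (t * Re z), exp (- t * Im z) * sin (t * Re z)).

Record SL2Z := mkSL2Z { ga : Z; gb : Z; gc : Z; gd : Z;
                        gdet : (ga * gd - gb * gc = 1)%Z }.

Definition inGamma0 (N : nat) (g : SL2Z) : Prop := (Z.of_nat N | gc g)%Z.

Definition autf (g : SL2Z) (z : C) : C :=
  Cplus (Cmult (RtoC (IZR (gc g))) z) (RtoC (IZR (gd g))).
Definition mob (g : SL2Z) (z : C) : C :=
  Cdiv (Cplus (Cmult (RtoC (IZR (ga g))) z) (RtoC (IZR (gb g)))) (autf g z).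

Definition slash (w : Z) (f : C -> C) (g : SL2Z) (z : C) : C :=
  Cmult (Cpowz (autf g z) (- w)) (f (mob g z)).

(* the cusp g(oo) is Gamma_0(N)-equivalent to oo:
   some d in Gamma_0(N) has d g upper triangular, i.e. (d g)(oo) = oo *)
Definition cusp_at_infty (N : nat) (g : SL2Z) : Prop :=
  exists d : SL2Z, inGamma0 N d /\ (gc d * ga g + gd d * gc g = 0)%Z.

(* f has a q-expansion at oo, f(z) = sum_{j >= -n0} a(j) q^j on the upper
   half-plane, with integer coefficients a (an element of Z((q))); a(j) = 0
   for j < -n0.  Such f is holomorphic on H and meromorphic at oo. *)
Definition qexp_int (f : C -> C) (a : Z -> Z) : Prop :=
  exists n0 : nat,
    (forall j : Z, (j < - Z.of_nat n0)%Z -> a j = 0%Z) /\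
    forall z : C, 0 < Im z ->
      @is_series C_AbsRing C_NormedModule
        (fun k : nat => Cmult (RtoC (IZR (a (Z.of_nat k - Z.of_nat n0)%Z)))
                              (qpow (Z.of_nat k - Z.of_nat n0)%Z z))
        (f z).

Definition modular (w : Z) (N : nat) (f : C -> C) : Prop :=
  forall g : SL2Z, inGamma0 N g ->
    forall z : C, 0 < Im z -> f (mob g z) = Cmult (Cpowz (autf g z) w) (f z).

(* f is in M_w^oo(Gamma_0(N)) /\ Z((q)), with q-expansion coefficients a:
   holomorphic at every cusp g(oo) not equivalent to oo, i.e. f|_w g is
   bounded as Im z -> oo. *)
Definition wh_form_Z (w : Z) (N : nat) (f : C -> C) (a : Z -> Z) : Prop :=
  qexp_int f a /\ modular w N f /\
  forall g : SL2Z, ~ cusp_at_infty N g ->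
    exists M Y : R, forall z : C, Y < Im z -> Cmod (slash w f g z) <= M.

(* f is in S_w^oo(Gamma_0(N)) /\ Z((q)): vanishes at every cusp g(oo) not
   equivalent to oo, i.e. f|_w g -> 0 as Im z -> oo (uniformly in Re z). *)
Definition wh_cusp_form_Z (w : Z) (N : nat) (f : C -> C) (a : Z -> Z) : Prop :=
  qexp_int f a /\ modular w N f /\
  forall g : SL2Z, ~ cusp_at_infty N g ->
    forall eps : R, 0 < eps ->
      exists Y : R, forall z : C, Y < Im z -> Cmod (slash w f g z) < eps.

Definition admissible (k : Z) (m : Z) : Prop :=
  if Z.eqb k 2 then (m = -1 \/ 1 <= m)%Z else (-1 <= m)%Z.

Definition phi_shape (k : Z) (n : Z) (A : Z -> Z) : Prop :=
  A (- n)%Z = 1%Z /\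
  forall j : Z, j <> (- n)%Z ->
    (if Z.eqb k 2 then (j < 1)%Z /\ j <> (-1)%Z else (j < -1)%Z) -> A j = 0%Z.

Definition F_shape (m : Z) (Cf : Z -> Z) : Prop :=
  Cf (- m)%Z = (-1)%Z /\
  forall j : Z, j <> (- m)%Z -> (j <= 1)%Z -> Cf j = 0%Z.

(* Main.v *)
Require Import Defs.
From Stdlib Require Import Reals ZArith Lra Lia List Permutation.
From Coquelicot Require Import Coquelicot.
Import ListNotations.

(** The product [G = phi F] has weight 2, and its constant term is [C_m(n) - A_n(m)], so it suffices
    to show that this constant term vanishes.  Let [P] be the termwise primitive of [G].  Then
    [P(z+1) - P(z)] is the constant term, and [P(g z) - P(z)] is constant for [g] in [Gamma_0(N)]
    because [G(z) dz] is invariant.  Hence [K(z) = sum_g P(g z)], over representatives of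
    [Gamma_0(N) \ SL_2(Z)], changes by additive constants under [S] and [ST]; these are zero because
    [S] and [ST] have the fixed points [i] and [rho].  So [K(z+1) = K(z)].  In
    [K(z+1) - K(z) = sum_g (P(g(z+1)) - P(g z))] the trivial coset contributes the constant term of
    [G], and every other coset contributes the integral of [G|g] from [z] to [z+1], which tends to 0
    as [Im z] grows, since [G] vanishes at the cusps other than infinity. *)

(** * Complex differentiability *)

(* Complex differentiability with a quadratic error term: this strong form is stable under
   sums and composition and holds for all the functions below. *)
Definition cderiv (f : C -> C) (z l : C) : Prop :=
  exists K d : R, 0 <= K /\ 0 < d /\ forall h : C, Cmod h < d ->
    Cmod (f (z + h) - f z - l * h)%C <= K * (Cmod h * Cmod h).

Lemma im_le_Cmod (z : C) : Rabs (Im z) <= Cmod z.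
Proof. eapply Rle_trans; [apply Rmax_r | apply Rmax_Cmod]. Qed.

Lemma Cmod_le_re_im (z : C) : Cmod z <= Rabs (Re z) + Rabs (Im z).
Proof.
  replace z with (RtoC (Re z) + Ci * RtoC (Im z))%C at 1.
  - eapply Rle_trans; [apply Cmod_triangle |].
    rewrite Cmod_mult, Cmod_Ci, !Cmod_R; lra.
  - destruct z as [x y]; unfold Ci, RtoC, Cmult, Cplus, Re, Im; simpl; f_equal; ring.
Qed.

Lemma cderiv_eq (f : C -> C) (z l l' : C) : l = l' -> cderiv f z l -> cderiv f z l'.
Proof. intros <-; exact (fun H => H). Qed.

Lemma cderiv_linear (a z : C) : cderiv (fun w => a * w)%C z a.
Proof.
  exists 0, 1; split; [lra | split; [lra |]]; intros h _.
  replace (a * (z + h) - a * z - a * h)%C with (RtoC 0) by ring.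
  rewrite Cmod_0; lra.
Qed.

Lemma cderiv_plus (f g : C -> C) (z l m : C) :
  cderiv f z l -> cderiv g z m -> cderiv (fun w => f w + g w)%C z (l + m)%C.
Proof.
  intros (K & d & HK & Hd & Hf) (K' & d' & HK' & Hd' & Hg).
  exists (K + K'), (Rmin d d'); split; [lra | split; [now apply Rmin_pos |]].
  intros h Hh.
  specialize (Hf h (Rlt_le_trans _ _ _ Hh (Rmin_l _ _))).
  specialize (Hg h (Rlt_le_trans _ _ _ Hh (Rmin_r _ _))).
  replace (f (z + h) + g (z + h) - (f z + g z) - (l + m) * h)%C
    with ((f (z + h) - f z - l * h) + (g (z + h) - g z - m * h))%C by ring.
  eapply Rle_trans; [apply Cmod_triangle | lra].
Qed.

Lemma cderiv_comp (f g : C -> C) (z l m : C) :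
  cderiv g z m -> cderiv f (g z) l -> cderiv (fun w => f (g w)) z (l * m)%C.
Proof.
  intros (K & d & HK & Hd & Hg) (K' & d' & HK' & Hd' & Hf).
  pose proof (Cmod_ge_0 m) as Hm; pose proof (Cmod_ge_0 l) as Hl.
  assert (Hdl : 0 < d' / (Cmod m + K + 1)) by (apply Rdiv_lt_0_compat; lra).
  (* The increment [k] of [g] is at most (|m| + K)|h| as soon as |h| < 1. The outer error is
     K'|k|^2, and the inner error K|h|^2 gets multiplied by |l|. The third bound on |h| forces |k| <
     d'. *)
  exists (K' * ((Cmod m + K) * (Cmod m + K)) + Cmod l * K), (Rmin (Rmin 1 d) (d' / (Cmod m + K + 1))).
  split; [apply Rplus_le_le_0_compat; repeat apply Rmult_le_pos; lra |].
  split; [repeat apply Rmin_pos; lra |].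
  intros h Hh.
  assert (H1 : Cmod h < 1)
    by (eapply Rlt_le_trans; [exact Hh | eapply Rle_trans; apply Rmin_l]).
  assert (H2 : Cmod h < d)
    by (eapply Rlt_le_trans; [exact Hh | eapply Rle_trans; [apply Rmin_l | apply Rmin_r]]).
  assert (H3 : Cmod h < d' / (Cmod m + K + 1))
    by (eapply Rlt_le_trans; [exact Hh | apply Rmin_r]).
  pose proof (Cmod_ge_0 h) as H0.
  specialize (Hg h H2).
  set (k := (g (z + h) - g z)%C) in *.
  assert (Hk : Cmod k <= (Cmod m + K) * Cmod h).
  { replace k with ((k - m * h) + m * h)%C by ring.
    eapply Rle_trans; [apply Cmod_triangle |]. rewrite Cmod_mult.
    assert (K * (Cmod h * Cmod h) <= K * (Cmod h * 1)) by (repeat apply Rmult_le_compat_l; lra).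
    lra. }
  assert (Hk' : Cmod k < d').
  { apply Rmult_lt_compat_r with (r := Cmod m + K + 1) in H3; [| lra].
    replace (d' / (Cmod m + K + 1) * (Cmod m + K + 1)) with d' in H3 by (field; lra).
    nra. }
  specialize (Hf k Hk').
  replace (g (z + h)%C) with (g z + k)%C by (unfold k; ring).
  replace (f (g z + k) - f (g z) - l * m * h)%C
    with ((f (g z + k) - f (g z) - l * k) + l * (k - m * h))%C by ring.
  eapply Rle_trans; [apply Cmod_triangle |]. rewrite Cmod_mult.
  pose proof (Cmod_ge_0 k) as Hk0.
  assert (Hkk : Cmod k * Cmod k <= ((Cmod m + K) * Cmod h) * ((Cmod m + K) * Cmod h))
    by now apply Rmult_le_compat.
  apply Rmult_le_compat_l with (r := K') in Hkk; [| assumption].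
  apply Rmult_le_compat_l with (r := Cmod l) in Hg; [| assumption].
  lra.
Qed.

Lemma is_derive_of_quadratic (f : R -> R) (x l K d : R) : 0 <= K -> 0 < d ->
  (forall s, Rabs s < d -> Rabs (f (x + s) - f x - l * s) <= K * (s * s)) ->
  is_derive f x l.
Proof.
  intros HK Hd H. apply is_derive_Reals. intros eps Heps.
  (* The divisor K + 1 covers the case K = 0. *)
  assert (Hp : 0 < eps / (K + 1)) by (apply Rdiv_lt_0_compat; lra).
  exists (mkposreal _ (Rmin_pos _ _ Hd Hp)); simpl; intros s Hs0 Hs.
  specialize (H s (Rlt_le_trans _ _ _ Hs (Rmin_l _ _))).
  assert (Hs2 : Rabs s < eps / (K + 1)) by (eapply Rlt_le_trans; [exact Hs | apply Rmin_r]).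
  assert (Hs3 : 0 < Rabs s) by now apply Rabs_pos_lt.
  replace ((f (x + s) - f x) / s - l) with ((f (x + s) - f x - l * s) / s) by (field; auto).
  unfold Rdiv; rewrite Rabs_mult, Rabs_inv.
  apply Rmult_lt_reg_r with (Rabs s); [assumption |].
  rewrite Rmult_assoc, Rinv_l, Rmult_1_r by lra.
  eapply Rle_lt_trans; [exact H |].
  replace (s * s) with (Rabs s * Rabs s) by (rewrite <- Rabs_mult; apply Rabs_pos_eq; nra).
  apply Rmult_lt_compat_r with (r := K + 1) in Hs2; [| lra].
  replace (eps / (K + 1) * (K + 1)) with eps in Hs2 by (field; lra).
  nra.
Qed.

(** * Mean value inequalities on segments *)

Lemma mean_value_real (f f' : R -> R) (B : R) :
  (forall t, 0 <= t <= 1 -> is_derive f t (f' t)) ->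
  (forall t, 0 <= t <= 1 -> Rabs (f' t) <= B) ->
  Rabs (f 1 - f 0) <= B.
Proof.
  intros Hd HB.
  destruct (MVT_gen f 0 1 f') as (c & Hc & Hfc).
  - intros x; rewrite Rmin_left, Rmax_right by lra; intros Hx; apply Hd; lra.
  - intros x; rewrite Rmin_left, Rmax_right by lra; intros Hx.
    apply derivable_continuous_pt.
    exists (f' x); apply is_derive_Reals, Hd; lra.
  - rewrite Rmin_left, Rmax_right in Hc by lra.
    rewrite Hfc, Rminus_0_r, Rmult_1_r; apply HB; lra.
Qed.

(** The mean value equality fails for complex values, so the real one is applied separately to the
    real and imaginary parts along the segment; this costs the factor 2. *)
Lemma mean_value_complex (f l : C -> C) (z v : C) (B : R) :
  (forall t, 0 <= t <= 1 -> cderiv f (z + RtoC t * v)%C (l (z + RtoC t * v)%C)) ->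
  (forall t, 0 <= t <= 1 -> Cmod (l (z + RtoC t * v)%C * v)%C <= B) ->
  Cmod (f (z + v) - f z)%C <= 2 * B.
Proof.
  intros Hd HB.
  (* [p] stands for [Re] or [Im]; additivity, real homogeneity and |p(a)| <= |a| are what the
     argument uses. *)
  assert (Hpart : forall p : C -> R, (forall a b, p (a - b)%C = p a - p b) ->
    (forall a s, p (a * RtoC s)%C = p a * s) -> (forall a, Rabs (p a) <= Cmod a) ->
    Rabs (p (f (z + v) - f z)%C) <= B).
  { intros p Hsub Hscal Hle. rewrite Hsub.
    replace (z + v)%C with (z + RtoC 1 * v)%C by ring.
    replace (f z) with (f (z + RtoC 0 * v)%C) by (f_equal; ring).
    apply (mean_value_real (fun t => p (f (z + RtoC t * v)%C))
             (fun t => p (l (z + RtoC t * v) * v)%C)).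
    - intros t Ht. destruct (Hd t Ht) as (K & d & HK & Hd' & Hf).
      pose proof (Cmod_ge_0 v) as Hv.
      assert (Hdv : 0 < d / (Cmod v + 1)) by (apply Rdiv_lt_0_compat; lra).
      apply is_derive_of_quadratic with (K * (Cmod v * Cmod v)) (d / (Cmod v + 1)); [nra | assumption |].
      intros s Hs.
      assert (Hsv : Cmod (RtoC s * v)%C < d).
      { rewrite Cmod_mult, Cmod_R.
        apply Rmult_lt_compat_r with (r := Cmod v + 1) in Hs; [| lra].
        replace (d / (Cmod v + 1) * (Cmod v + 1)) with d in Hs by (field; lra).
        pose proof (Rabs_pos s); nra. }
      specialize (Hf _ Hsv).
      rewrite <- Hscal, <- !Hsub.
      eapply Rle_trans; [apply Hle |].
      replace (z + RtoC (t + s) * v)%C with (z + RtoC t * v + RtoC s * v)%C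
        by (rewrite RtoC_plus; ring).
      replace (l (z + RtoC t * v)%C * v * RtoC s)%C with (l (z + RtoC t * v)%C * (RtoC s * v))%C by ring.
      eapply Rle_trans; [exact Hf |].
      rewrite Cmod_mult, Cmod_R.
      assert (Rabs s * Rabs s = s * s) by (rewrite <- Rabs_mult; apply Rabs_pos_eq; nra).
      right; transitivity (K * (Cmod v * Cmod v) * (Rabs s * Rabs s)); [ring |].
      now rewrite H.
    - intros t Ht; eapply Rle_trans; [apply Hle | now apply HB]. }
  eapply Rle_trans; [apply Cmod_le_re_im |].
  assert (Rabs (Re (f (z + v) - f z)%C) <= B).
  { apply Hpart; [| | exact re_le_Cmod]; intros.
    - destruct a, b; unfold Re; simpl; ring.
    - destruct a; unfold Re; simpl; ring. }
  assert (Rabs (Im (f (z + v) - f z)%C) <= B).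
  { apply Hpart; [| | exact im_le_Cmod]; intros.
    - destruct a, b; unfold Im; simpl; ring.
    - destruct a; unfold Im; simpl; ring. }
  lra.
Qed.

Lemma upper_half_plane_convex (z w : C) (t : R) :
  0 < Im z -> 0 < Im w -> 0 <= t <= 1 -> 0 < Im (z + RtoC t * (w - z))%C.
Proof.
  destruct z as [x y], w as [x' y']; unfold Im, RtoC; simpl; intros.
  destruct (Req_dec t 0) as [-> |]; nra.
Qed.

(** This is the mean value inequality with bound 0 along the segment from z to w, which stays in the
    half-plane by convexity. *)
Lemma constant_of_cderiv_0 (f : C -> C) :
  (forall z, 0 < Im z -> cderiv f z (RtoC 0)) ->
  forall z w, 0 < Im z -> 0 < Im w -> f w = f z.
Proof.
  intros H z w Hz Hw.
  assert (Hle : Cmod (f (z + (w - z)) - f z)%C <= 2 * 0).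
  { apply mean_value_complex with (l := fun _ => RtoC 0).
    - intros t Ht. now apply H, upper_half_plane_convex.
    - intros t Ht; rewrite Cmod_mult, Cmod_0; lra. }
  replace (z + (w - z))%C with w in Hle by ring.
  assert (H0 : (f w - f z)%C = RtoC 0).
  { apply Cmod_eq_0. pose proof (Cmod_ge_0 (f w - f z)%C); lra. }
  replace (f w) with ((f w - f z) + f z)%C by ring.
  rewrite H0; ring.
Qed.

(** * The exponential and the functions q^j *)

Definition cexp (w : C) : C := (exp (Re w) * cos (Im w), exp (Re w) * sin (Im w)).

Lemma cexp_plus (v w : C) : cexp (v + w)%C = (cexp v * cexp w)%C.
Proof.
  destruct v as [a b], w as [c d]; unfold cexp, Re, Im; simpl.
  rewrite exp_plus, cos_plus, sin_plus; unfold Cmult; simpl; f_equal; ring.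
Qed.

Lemma Cmod_cexp (w : C) : Cmod (cexp w) = exp (Re w).
Proof.
  unfold Cmod, cexp; simpl.
  replace (exp (Re w) * cos (Im w) * (exp (Re w) * cos (Im w) * 1)
           + exp (Re w) * sin (Im w) * (exp (Re w) * sin (Im w) * 1))
    with (Rsqr (exp (Re w)) * (Rsqr (sin (Im w)) + Rsqr (cos (Im w)))) by (unfold Rsqr; ring).
  rewrite sin2_cos2, Rmult_1_r; apply sqrt_Rsqr, Rlt_le, exp_pos.
Qed.

(** The function of t bounded here is the real part of (a - ib) exp(t(u + iv)). This family is
    closed under differentiation, and (a, b) = (1, 0) and (0, 1) give the real and imaginary parts
    of the exponential. *)
Lemma exp_trig_bound (u v a b W t : R) : Rabs u <= W -> 0 <= t <= 1 ->
  Rabs (exp (t * u) * (a * cos (t * v) + b * sin (t * v))) <= (Rabs a + Rabs b) * exp W.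
Proof.
  intros Hu Ht.
  assert (He : exp (t * u) <= exp W).
  { destruct (Rle_lt_or_eq_dec (t * u) W) as [H | ->]; [| now left; apply exp_increasing | lra].
    pose proof (Rle_abs u); pose proof (Rabs_pos u); nra. }
  rewrite Rabs_mult, (Rabs_pos_eq (exp _)) by (left; apply exp_pos).
  rewrite Rmult_comm; apply Rmult_le_compat; try apply Rabs_pos; try (left; apply exp_pos); auto.
  eapply Rle_trans; [apply Rabs_triang |]; rewrite !Rabs_mult.
  assert (Rabs (cos (t * v)) <= 1) by (apply Rabs_le, COS_bound).
  assert (Rabs (sin (t * v)) <= 1) by (apply Rabs_le, SIN_bound).
  pose proof (Rabs_pos a); pose proof (Rabs_pos b); nra.
Qed.

Lemma exp_trig_derive (u v a b t : R) :
  is_derive (fun t => exp (t * u) * (a * cos (t * v) + b * sin (t * v))) t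
    (exp (t * u) * ((u * a + v * b) * cos (t * v) + (u * b - v * a) * sin (t * v))).
Proof. auto_derive; [exact I | ring]. Qed.

Lemma exp_trig_lipschitz (u v a b W s : R) : Rabs u <= W -> Rabs v <= W -> 0 <= s <= 1 ->
  Rabs (exp (s * u) * (a * cos (s * v) + b * sin (s * v)) - a)
    <= 2 * W * (Rabs a + Rabs b) * exp W.
Proof.
  intros Hu Hv Hs.
  pose proof (Rabs_pos a); pose proof (Rabs_pos b); pose proof (Rabs_pos u); pose proof (Rabs_pos v).
  assert (Hsu : Rabs (s * u) <= W) by (rewrite Rabs_mult, (Rabs_pos_eq s) by lra; nra).
  assert (Hsv : Rabs (s * v) <= W) by (rewrite Rabs_mult, (Rabs_pos_eq s) by lra; nra).
  pose proof (mean_value_real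
    (fun t => exp (t * (s * u)) * (a * cos (t * (s * v)) + b * sin (t * (s * v)))) _
    (2 * W * (Rabs a + Rabs b) * exp W) (fun t _ => exp_trig_derive (s * u) (s * v) a b t)) as M.
  cbv beta in M.
  rewrite !Rmult_0_l, exp_0, cos_0, sin_0, !Rmult_1_l, Rmult_1_r, Rmult_0_r, Rplus_0_r in M.
  apply M; intros t Ht.
  eapply Rle_trans; [apply (exp_trig_bound _ _ _ _ W); assumption |].
  apply Rmult_le_compat_r; [left; apply exp_pos |].
  assert (Rabs (s * u * a + s * v * b) <= W * (Rabs a + Rabs b)).
  { eapply Rle_trans; [apply Rabs_triang |]; rewrite (Rabs_mult _ a), (Rabs_mult _ b); nra. }
  assert (Rabs (s * u * b - s * v * a) <= W * (Rabs a + Rabs b)).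
  { unfold Rminus; eapply Rle_trans; [apply Rabs_triang |].
    rewrite Rabs_Ropp, (Rabs_mult _ a), (Rabs_mult _ b); nra. }
  lra.
Qed.

(** First-order Taylor remainder by two mean value steps. After subtraction of the linear term, the
    derivative is a member of the same family minus its value at 0, which [exp_trig_lipschitz]
    bounds. Each of the two parts contributes 4 W^2 exp W. *)
Lemma cexp_quadratic (w : C) :
  Cmod (cexp w - RtoC 1 - w)%C <= 8 * (Cmod w * Cmod w) * exp (Cmod w).
Proof.
  set (W := Cmod w).
  pose proof (re_le_Cmod w) as Hu; pose proof (im_le_Cmod w) as Hv; fold W in Hu, Hv.
  destruct w as [u v]; unfold Re, Im in Hu, Hv; simpl in Hu, Hv.
  pose proof (Rabs_pos u) as Hu0; pose proof (Rabs_pos v) as Hv0.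
  pose proof (exp_pos W) as HW.
  assert (Hstep : forall a b a' b', Rabs a' + Rabs b' <= 2 * W ->
    a' = u * a + v * b -> b' = u * b - v * a ->
    Rabs (exp u * (a * cos v + b * sin v) - a - a') <= 4 * (W * W) * exp W).
  { intros a b a' b' Hab Ha Hb.
    pose proof (mean_value_real
      (fun t => exp (t * u) * (a * cos (t * v) + b * sin (t * v)) - t * a')
      (fun t => exp (t * u) * (a' * cos (t * v) + b' * sin (t * v)) - a')
      (4 * (W * W) * exp W)) as M.
    cbv beta in M.
    rewrite !Rmult_0_l, exp_0, cos_0, sin_0, !Rmult_1_l, Rmult_1_r, Rmult_0_r, Rplus_0_r, Rminus_0_r in M.
    replace (exp u * (a * cos v + b * sin v) - a - a')
      with (exp u * (a * cos v + b * sin v) - a' - a) by ring.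
    apply M; intros t Ht.
    - subst a' b'. auto_derive; [exact I | ring].
    - eapply Rle_trans; [apply exp_trig_lipschitz with (W := W); assumption |].
      apply Rmult_le_compat_r; [lra | nra]. }
  eapply Rle_trans; [apply Cmod_le_re_im |].
  assert (H1 := Hstep 1 0 u (- v)). assert (H2 := Hstep 0 1 v u).
  rewrite Rabs_Ropp in H1.
  unfold cexp, Re, Im; simpl.
  replace (exp u * cos v + - (1) + - u) with (exp u * (1 * cos v + 0 * sin v) - 1 - u) by ring.
  replace (exp u * sin v + - 0 + - v) with (exp u * (0 * cos v + 1 * sin v) - 0 - v) by ring.
  lapply H1; [| lra]; lapply H2; [| lra]; intros H2' H1'.
  lapply H1'; [| ring]; lapply H2'; [| ring]; clear; intros H2 H1.
  lapply H1; [| ring]; lapply H2; [| ring]; lra.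
Qed.

Definition imag (t : R) : C := (0, t).

Lemma qpow_cexp (j : Z) (z : C) : qpow j z = cexp (imag (2 * PI * IZR j) * z)%C.
Proof.
  destruct z as [x y]; unfold qpow, cexp, imag, Re, Im; simpl.
  replace (0 * x - 2 * PI * IZR j * y) with (- (2 * PI * IZR j) * y) by ring.
  replace (0 * y + 2 * PI * IZR j * x) with (2 * PI * IZR j * x) by ring.
  reflexivity.
Qed.

Lemma qpow_add (i j : Z) (z : C) : qpow (i + j) z = (qpow i z * qpow j z)%C.
Proof.
  rewrite !qpow_cexp, <- cexp_plus; f_equal.
  destruct z as [x y]; unfold imag, Cmult, Cplus; simpl; rewrite plus_IZR; f_equal; ring.
Qed.

Lemma qpow_0 (z : C) : qpow 0 z = RtoC 1.
Proof.
  unfold qpow; rewrite Rmult_0_r, Ropp_0, !Rmult_0_l, exp_0, cos_0, sin_0.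
  unfold RtoC; f_equal; ring.
Qed.

Lemma Cmod_qpow (j : Z) (z : C) : Cmod (qpow j z) = exp (- (2 * PI * IZR j) * Im z).
Proof.
  rewrite qpow_cexp, Cmod_cexp; destruct z as [x y]; unfold Re, Im; simpl; f_equal; ring.
Qed.

Lemma qpow_period (j : Z) (z : C) : qpow j (z + RtoC 1)%C = qpow j z.
Proof.
  destruct z as [x y]; unfold qpow, Re, Im, RtoC; simpl; rewrite Rplus_0_r.
  assert (E : exists k : nat, IZR j = INR k \/ IZR j = - INR k).
  { exists (Z.abs_nat j); rewrite INR_IZR_INZ, Zabs2Nat.id_abs, <- opp_IZR.
    destruct (Z.abs_spec j) as [[_ ->] | [_ ->]]; [left | right]; f_equal; lia. }
  destruct E as (k & [-> | ->]).
  - replace (2 * PI * INR k * (x + 1)) with (2 * PI * INR k * x + 2 * INR k * PI) by ring.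
    now rewrite cos_period, sin_period.
  - rewrite <- (cos_period (_ * (x + 1)) k), <- (sin_period (_ * (x + 1)) k).
    replace (2 * PI * - INR k * (x + 1) + 2 * INR k * PI) with (2 * PI * - INR k * x) by ring.
    reflexivity.
Qed.

(** Factor q^j(z + h) = q^j(z) exp(w) with w = 2 pi i j h. The bound is kept explicit in j so that
    it can be summed over all terms of a series. *)
Lemma qpow_quadratic (j : Z) (z h : C) :
  Cmod (qpow j (z + h) - qpow j z - imag (2 * PI * IZR j) * qpow j z * h)%C
  <= exp (- (2 * PI * IZR j) * Im z) *
     (8 * ((2 * PI * Rabs (IZR j) * Cmod h) * (2 * PI * Rabs (IZR j) * Cmod h))
        * exp (2 * PI * Rabs (IZR j) * Cmod h)).
Proof.
  set (w := (imag (2 * PI * IZR j) * h)%C).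
  assert (Hw : Cmod w = 2 * PI * Rabs (IZR j) * Cmod h).
  { unfold w; rewrite Cmod_mult; f_equal.
    replace (imag (2 * PI * IZR j)) with (Ci * RtoC (2 * PI * IZR j))%C
      by (unfold imag, Ci, RtoC, Cmult; simpl; f_equal; ring).
    pose proof PI_RGT_0.
    rewrite Cmod_mult, Cmod_Ci, Cmod_R, Rmult_1_l, Rabs_mult, (Rabs_pos_eq (2 * PI)); lra. }
  replace (qpow j (z + h)%C) with (qpow j z * cexp w)%C.
  - replace (qpow j z * cexp w - qpow j z - imag (2 * PI * IZR j) * qpow j z * h)%C
      with (qpow j z * (cexp w - RtoC 1 - w))%C by (unfold w; ring).
    rewrite Cmod_mult, Cmod_qpow, <- Hw.
    apply Rmult_le_compat_l; [left; apply exp_pos | apply cexp_quadratic].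
  - rewrite !qpow_cexp, <- cexp_plus; f_equal; unfold w; ring.
Qed.

(** * Absolutely convergent complex series *)

(** Built from real [Series], hence total: rewriting needs no limit witness, and the value is
    meaningful under [csummable]. *)
Definition CSeries (u : nat -> C) : C :=
  (Series (fun k => Re (u k)), Series (fun k => Im (u k))).

Definition csummable (u : nat -> C) : Prop := ex_series (fun k => Cmod (u k)).

Lemma ex_series_dominated (a b : nat -> R) (K : R) :
  (forall k, Rabs (a k) <= K * b k) -> ex_series b -> ex_series a.
Proof.
  intros H Hb. apply (ex_series_le (V := R_CompleteNormedModule) a (fun k => K * b k)).
  - exact H.
  - exact (ex_series_scal (V := R_NormedModule) K b Hb).
Qed.

Lemma csummable_dominated (u : nat -> C) (b : nat -> R) (K : R) :
  (forall k, Cmod (u k) <= K * b k) -> ex_series b -> csummable u.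
Proof.
  intros H; apply ex_series_dominated with (K := K); intros k.
  rewrite Rabs_pos_eq by apply Cmod_ge_0; apply H.
Qed.

Lemma csummable_scal (a : C) (u : nat -> C) : csummable u -> csummable (fun k => a * u k)%C.
Proof. apply csummable_dominated with (K := Cmod a); intros k; right; apply Cmod_mult. Qed.

Lemma csummable_plus (u v : nat -> C) :
  csummable u -> csummable v -> csummable (fun k => u k + v k)%C.
Proof.
  intros Hu Hv.
  apply csummable_dominated with (fun k => Cmod (u k) + Cmod (v k)) 1.
  - intros k; rewrite Rmult_1_l; apply Cmod_triangle.
  - exact (ex_series_plus (V := R_NormedModule) _ _ Hu Hv).
Qed.

Lemma csummable_re (u : nat -> C) : csummable u -> ex_series (fun k => Rabs (Re (u k))).
Proof.
  apply ex_series_dominated with (K := 1); intros k; rewrite Rabs_Rabsolu, Rmult_1_l.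
  apply re_le_Cmod.
Qed.

Lemma csummable_im (u : nat -> C) : csummable u -> ex_series (fun k => Rabs (Im (u k))).
Proof.
  apply ex_series_dominated with (K := 1); intros k; rewrite Rabs_Rabsolu, Rmult_1_l.
  apply im_le_Cmod.
Qed.

Lemma CSeries_ext (u v : nat -> C) : (forall k, u k = v k) -> CSeries u = CSeries v.
Proof. intros H; unfold CSeries; f_equal; apply Series_ext; intros k; now rewrite H. Qed.

Lemma CSeries_plus (u v : nat -> C) : csummable u -> csummable v ->
  CSeries (fun k => u k + v k)%C = (CSeries u + CSeries v)%C.
Proof.
  intros Hu Hv; unfold CSeries, Cplus; simpl.
  f_equal; apply Series_plus; apply ex_series_Rabs;
    first [now apply csummable_re | now apply csummable_im].
Qed.

Lemma CSeries_scal (a : C) (u : nat -> C) : csummable u ->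
  CSeries (fun k => a * u k)%C = (a * CSeries u)%C.
Proof.
  intros Hu; destruct a as [x y]; unfold CSeries, Cmult; simpl.
  assert (Hr := ex_series_Rabs _ (csummable_re _ Hu)).
  assert (Hi := ex_series_Rabs _ (csummable_im _ Hu)).
  rewrite <- !Series_scal_l.
  rewrite <- Series_minus, <- Series_plus; try reflexivity;
    now apply (ex_series_scal (V := R_NormedModule)).
Qed.

Lemma Cmod_CSeries (u : nat -> C) (b : nat -> R) :
  (forall k, Cmod (u k) <= b k) -> ex_series b -> Cmod (CSeries u) <= 2 * Series b.
Proof.
  intros H Hb.
  assert (Hu : csummable u)
    by (apply csummable_dominated with b 1; [intros k; rewrite Rmult_1_l; apply H | exact Hb]).
  eapply Rle_trans; [apply Cmod_le_re_im |].
  change (Rabs (Series (fun k => Re (u k))) + Rabs (Series (fun k => Im (u k))) <= 2 * Series b).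
  assert (Rabs (Series (fun k => Re (u k))) <= Series b).
  { eapply Rle_trans; [now apply Series_Rabs, csummable_re |].
    apply Series_le; [| exact Hb]; intros k; split; [apply Rabs_pos |].
    eapply Rle_trans; [apply re_le_Cmod | apply H]. }
  assert (Rabs (Series (fun k => Im (u k))) <= Series b).
  { eapply Rle_trans; [now apply Series_Rabs, csummable_im |].
    apply Series_le; [| exact Hb]; intros k; split; [apply Rabs_pos |].
    eapply Rle_trans; [apply im_le_Cmod | apply H]. }
  lra.
Qed.

Lemma sum_n_re_im (u : nat -> C) (n : nat) :
  @sum_n C_AbelianMonoid u n = (sum_n (fun k => Re (u k)) n, sum_n (fun k => Im (u k)) n).
Proof.
  induction n as [| n IH].
  - rewrite !sum_O; apply surjective_pairing.
  - rewrite !sum_Sn, IH; reflexivity.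
Qed.

Lemma is_series_re_im (u : nat -> C) (l : C) :
  @is_series C_AbsRing C_NormedModule u l ->
  is_series (fun k => Re (u k)) (Re l) /\ is_series (fun k => Im (u k)) (Im l).
Proof.
  intros H; split; apply filterlim_locally; intros eps;
    generalize (proj1 (filterlim_locally _ _) H eps); apply filter_imp; intros n;
    intros Hn; change (ball (M := C_UniformSpace) l eps (sum_n u n)) in Hn;
    rewrite sum_n_re_im in Hn; apply Hn.
Qed.

Lemma CSeries_is_series (u : nat -> C) (l : C) :
  @is_series C_AbsRing C_NormedModule u l -> CSeries u = l.
Proof.
  intros H; destruct (is_series_re_im _ _ H) as [Hr Hi]; unfold CSeries.
  rewrite (is_series_unique _ _ Hr), (is_series_unique _ _ Hi).
  symmetry; apply surjective_pairing.
Qed.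

(** Serves to split the constant term off a Laurent series. *)
Lemma CSeries_single (M : nat) (c : C) :
  csummable (fun k => if Nat.eqb k M then c else RtoC 0) /\
  CSeries (fun k => if Nat.eqb k M then c else RtoC 0) = c.
Proof.
  assert (H : forall x : R, is_series (fun k => if Nat.eqb k M then x else 0) x).
  { intros x.
    assert (Hs : forall n, sum_n (fun k => if Nat.eqb k M then x else 0) n = if Nat.leb M n then x else 0).
    { induction n as [| n IH].
      - rewrite sum_O; destruct M; reflexivity.
      - rewrite sum_Sn, IH.
        change ((if Nat.leb M n then x else 0) + (if Nat.eqb (S n) M then x else 0)
                = if Nat.leb M (S n) then x else 0).
        destruct (Nat.eqb_spec (S n) M), (Nat.leb_spec M n), (Nat.leb_spec M (S n)); try lia; ring. }
    apply filterlim_locally; intros eps; exists M; intros n Hn.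
    rewrite Hs, (proj2 (Nat.leb_le _ _) Hn); apply ball_center. }
  split.
  - exists (Cmod c); eapply is_series_ext; [| apply H].
    intros k; simpl; destruct (Nat.eqb k M); [| rewrite Cmod_0]; reflexivity.
  - destruct c as [x y]; unfold CSeries; f_equal; apply is_series_unique;
      (eapply is_series_ext; [| apply H]); intros k; simpl; destruct (Nat.eqb k M); reflexivity.
Qed.

(** * Cauchy products of complex series *)

Fixpoint csum (u : nat -> C) (n : nat) : C :=
  match n with O => u O | S n' => (csum u n' + u n)%C end.

Lemma csum_ext (u v : nat -> C) (n : nat) :
  (forall k, (k <= n)%nat -> u k = v k) -> csum u n = csum v n.
Proof.
  induction n as [| n IH]; intros H; simpl; [now apply H |].
  rewrite IH, H; auto.
Qed.

Lemma csum_RtoC_scal (a : nat -> R) (c : C) (n : nat) :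
  csum (fun k => RtoC (a k) * c)%C n = (RtoC (sum_f_R0 a n) * c)%C.
Proof. induction n as [| n IH]; simpl; [reflexivity |]. rewrite IH, RtoC_plus; ring. Qed.

Lemma Cmod_csum (u : nat -> C) (n : nat) : Cmod (csum u n) <= sum_f_R0 (fun k => Cmod (u k)) n.
Proof.
  induction n as [| n IH]; simpl; [lra |].
  eapply Rle_trans; [apply Cmod_triangle | lra].
Qed.

Lemma csum_re_im (u : nat -> C) (n : nat) :
  Re (csum u n) = sum_f_R0 (fun k => Re (u k)) n /\ Im (csum u n) = sum_f_R0 (fun k => Im (u k)) n.
Proof.
  induction n as [| n [IHr IHi]]; [split; reflexivity |].
  simpl; rewrite <- IHr, <- IHi; split; reflexivity.
Qed.

(** The moduli have a convergent Cauchy product, which dominates. For the value, the real and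
    imaginary parts reduce to the four real Cauchy products Re Re, Im Im, Re Im and Im Re. *)
Lemma CSeries_mult (u v : nat -> C) : csummable u -> csummable v ->
  csummable (fun n => csum (fun k => u k * v (n - k)%nat) n)%C /\
  CSeries (fun n => csum (fun k => u k * v (n - k)%nat) n)%C = (CSeries u * CSeries v)%C.
Proof.
  intros Hu Hv; split.
  - assert (Habs : forall w, csummable w -> ex_series (fun n => Rabs (Cmod (w n)))).
    { intros w; apply ex_series_dominated with (K := 1); intros k.
      rewrite Rabs_Rabsolu, Rabs_pos_eq, Rmult_1_l by apply Cmod_ge_0; apply Rle_refl. }
    apply csummable_dominated with (K := 1)
      (b := fun n => sum_f_R0 (fun k => Cmod (u k) * Cmod (v (n - k)%nat)) n).
    + intros n; rewrite Rmult_1_l. eapply Rle_trans; [apply Cmod_csum |].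
      right; apply sum_eq; intros; apply Cmod_mult.
    + eexists; apply (is_series_mult (fun k => Cmod (u k)) (fun k => Cmod (v k)));
        try apply Series_correct; auto.
  - assert (Hur := csummable_re _ Hu); assert (Hui := csummable_im _ Hu).
    assert (Hvr := csummable_re _ Hv); assert (Hvi := csummable_im _ Hv).
    assert (S1 := is_series_mult _ _ _ _ (Series_correct _ (ex_series_Rabs _ Hur))
                    (Series_correct _ (ex_series_Rabs _ Hvr)) Hur Hvr).
    assert (S2 := is_series_mult _ _ _ _ (Series_correct _ (ex_series_Rabs _ Hui))
                    (Series_correct _ (ex_series_Rabs _ Hvi)) Hui Hvi).
    assert (S3 := is_series_mult _ _ _ _ (Series_correct _ (ex_series_Rabs _ Hur))
                    (Series_correct _ (ex_series_Rabs _ Hvi)) Hur Hvi).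
    assert (S4 := is_series_mult _ _ _ _ (Series_correct _ (ex_series_Rabs _ Hui))
                    (Series_correct _ (ex_series_Rabs _ Hvr)) Hui Hvr).
    unfold CSeries at 1, Cmult at 3; f_equal; apply is_series_unique.
    + eapply is_series_ext; [| apply (is_series_minus _ _ _ _ S1 S2)].
      intros n; rewrite (proj1 (csum_re_im _ _)).
      symmetry; etransitivity; [| apply minus_sum].
      apply sum_eq; intros; reflexivity.
    + eapply is_series_ext; [| apply (is_series_plus _ _ _ _ S3 S4)].
      intros n; rewrite (proj2 (csum_re_im _ _)).
      symmetry; etransitivity; [| apply plus_sum].
      apply sum_eq; intros; reflexivity.
Qed.

(** * Laurent series in q *)

(** Laurent coefficients are indexed by natural numbers, shifted by a bound [M] on the order of the
    pole: [c k] belongs to q^(k - M), so [c M] is the constant term. *)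
Definition qterm (c : nat -> R) (M : nat) (z : C) (k : nat) : C :=
  (RtoC (c k) * qpow (Z.of_nat k - Z.of_nat M) z)%C.

Definition qser (c : nat -> R) (M : nat) (z : C) : C := CSeries (qterm c M z).

Definition qsummable (c : nat -> R) (M : nat) : Prop :=
  forall z, 0 < Im z -> csummable (qterm c M z).

Lemma Cmod_qterm (c : nat -> R) (M : nat) (z : C) (k : nat) :
  Cmod (qterm c M z k) = Rabs (c k) * exp (- (2 * PI * IZR (Z.of_nat k - Z.of_nat M)) * Im z).
Proof. unfold qterm; now rewrite Cmod_mult, Cmod_R, Cmod_qpow. Qed.

Lemma exp_mult_nat (x : R) (k : nat) : exp (INR k * x) = exp x ^ k.
Proof.
  induction k as [| k IH]; [now rewrite Rmult_0_l, exp_0 |].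
  rewrite S_INR, Rmult_plus_distr_r, Rmult_1_l, exp_plus, IH; simpl; ring.
Qed.

(* Boundedness of the terms at height y/2 gives geometric decay at height y. *)
Lemma qsummable_of_is_series (c : nat -> R) (M : nat) :
  (forall z, 0 < Im z -> exists l, @is_series C_AbsRing C_NormedModule (qterm c M z) l) ->
  qsummable c M.
Proof.
  intros H z Hz; set (y := Im z) in *.
  (* On the imaginary axis q^j is real and positive, so bounded real parts bound |c k| |q^j| at
     height y/2. Passing to height y multiplies by exp(- pi (k - M) y), a geometric factor. *)
  destruct (H (0, y / 2)) as (l & Hl); [unfold Im; simpl; lra |].
  destruct (is_series_re_im _ _ Hl) as [Hr _].
  assert (Hlim := proj1 (is_lim_seq_Reals _ _) (ex_series_lim_0 _ (ex_intro _ _ Hr))).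
  destruct (maj_by_pos _ (exist _ 0 Hlim)) as (B & HB & Hbound).
  apply csummable_dominated with (b := fun k => exp (- PI * y) ^ k) (K := B * exp (PI * INR M * y)).
  - intros k; rewrite Cmod_qterm; fold y.
    specialize (Hbound k); unfold qterm, qpow, Re, Im, RtoC, Cmult in Hbound; simpl in Hbound.
    rewrite Rmult_0_r, cos_0, Rmult_0_l, Rminus_0_r, Rmult_1_r, Rabs_mult in Hbound.
    rewrite (Rabs_pos_eq (exp _)) in Hbound by (left; apply exp_pos).
    rewrite <- exp_mult_nat, (Rmult_assoc B), <- exp_plus.
    rewrite minus_IZR, <- !INR_IZR_INZ in *.
    replace (- (2 * PI * (INR k - INR M)) * y)
      with (- (2 * PI * (INR k - INR M)) * (y / 2) + (PI * INR M * y + INR k * (- PI * y))) by field.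
    rewrite exp_plus, <- Rmult_assoc.
    apply Rmult_le_compat_r; [left; apply exp_pos | exact Hbound].
  - apply ex_series_geom. rewrite Rabs_pos_eq by (left; apply exp_pos).
    rewrite <- exp_0; apply exp_increasing. pose proof PI_RGT_0; nra.
Qed.

(* The exponent k - M is at least - M, so |k - M| exceeds k - M by at most 2 M. *)
Lemma qterm_index_bound (M k : nat) (y : R) : 0 < y ->
  exp (PI * Rabs (IZR (Z.of_nat k - Z.of_nat M)) * y)
  <= exp (2 * PI * INR M * y) * exp (PI * IZR (Z.of_nat k - Z.of_nat M) * y).
Proof.
  intros Hy; rewrite <- exp_plus.
  set (j := IZR (Z.of_nat k - Z.of_nat M)).
  assert (Hj : - INR M <= j).
  { unfold j; rewrite minus_IZR, <- !INR_IZR_INZ; pose proof (pos_INR k); lra. }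
  pose proof PI_RGT_0; pose proof (pos_INR M).
  assert (Hle : Rabs j <= 2 * INR M + j) by (unfold Rabs; destruct (Rcase_abs j); lra).
  assert (PI * Rabs j * y <= 2 * PI * INR M * y + PI * j * y).
  { replace (2 * PI * INR M * y + PI * j * y) with (PI * (2 * INR M + j) * y) by ring.
    apply Rmult_le_compat_r; [lra |]; apply Rmult_le_compat_l; lra. }
  destruct (Rle_lt_or_eq_dec _ _ H1) as [H2 | ->]; [left; now apply exp_increasing | lra].
Qed.

Lemma exp_ge_self (s : R) : s <= exp s.
Proof. pose proof (exp_ineq1_le s); lra. Qed.

Lemma exp_ge_square (s : R) : 0 <= s -> s * s <= 4 * exp s.
Proof.
  intros Hs; replace s with (s / 2 + s / 2) at 3 by field.
  rewrite exp_plus; pose proof (exp_ineq1_le (s / 2)); nra.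
Qed.

Lemma half_height (z : C) : 0 < Im z -> 0 < Im (0, Im z / 2).
Proof. unfold Im at 2; simpl; lra. Qed.

(** Halving the height absorbs the index: with j = k - M, |j| <= exp(pi |j| y) / (pi y), while the
    term at height y/2 exceeds the one at height y by the factor exp(pi j y). *)
Lemma qsummable_index (c : nat -> R) (M : nat) : qsummable c M ->
  qsummable (fun k => c k * IZR (Z.of_nat k - Z.of_nat M)) M.
Proof.
  intros Hc z Hz.
  pose proof (Hc _ (half_height _ Hz)) as Hs.
  set (y := Im z) in *.
  apply csummable_dominated with (b := fun k => Cmod (qterm c M (0, y / 2) k))
    (K := exp (2 * PI * INR M * y) / (PI * y)); [| exact Hs].
  intros k; rewrite !Cmod_qterm; fold y.
  change (Im (0, y / 2)) with (y / 2).
  rewrite Rabs_mult.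
  pose proof (qterm_index_bound M k y Hz) as Hb.
  set (j := IZR (Z.of_nat k - Z.of_nat M)) in *.
  pose proof PI_RGT_0 as HPI.
  assert (Hpy : 0 < PI * y) by nra.
  pose proof (exp_ge_self (PI * Rabs j * y)) as Hs1.
  replace (- (2 * PI * j) * (y / 2)) with (- (2 * PI * j) * y + PI * j * y) by field.
  rewrite exp_plus.
  set (E := exp (2 * PI * INR M * y)) in *. set (F := exp (PI * j * y)) in *.
  assert (Hj : Rabs j <= E * F / (PI * y)).
  { apply Rmult_le_reg_r with (PI * y); [assumption |].
    unfold Rdiv; rewrite Rmult_assoc, Rinv_l, Rmult_1_r by lra. lra. }
  apply Rmult_le_compat_l with (r := Rabs (c k) * exp (- (2 * PI * j) * y)) in Hj.
  - eapply Rle_trans; [| eapply Rle_trans; [exact Hj |]]; right; [ring | field; lra].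
  - apply Rmult_le_pos; [apply Rabs_pos | left; apply exp_pos].
Qed.

(** Termwise differentiation: the quadratic remainders of the single powers q^j are summed, each
    being dominated by |h|^2 times the term at height y/2. *)
Lemma qser_cderiv (c : nat -> R) (M : nat) (z : C) : qsummable c M -> 0 < Im z ->
  cderiv (qser c M) z
    (imag (2 * PI) * qser (fun k => c k * IZR (Z.of_nat k - Z.of_nat M))%R M z)%C.
Proof.
  intros Hc Hz.
  pose proof (Hc _ (half_height _ Hz)) as Hs.
  pose proof (qsummable_index _ _ Hc z Hz) as Hcj.
  set (y := Im z) in *. set (b := fun k => Cmod (qterm c M (0, y / 2) k)).
  (* With s = 2 pi |j| y/4, the factor 8 (2 pi |j| |h|)^2 equals 128 s^2 |h|^2 / y^2, and s^2 <= 4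
     exp s turns 128 into 512. The remaining exp s exp s = exp(pi |j| y) is handled by
     [qterm_index_bound]. *)
  set (K := 512 / (y * y) * exp (2 * PI * INR M * y)).
  pose proof PI_RGT_0 as HPI.
  assert (HK : 0 <= K).
  { apply Rmult_le_pos; [| left; apply exp_pos]; left; apply Rdiv_lt_0_compat; nra. }
  (* The radius y/4 keeps z + h in the half-plane and gives exp(2 pi |j| |h|) <= exp s. The absolute
     value makes the constant visibly nonnegative. *)
  exists (2 * (K * Rabs (Series b))), (y / 4); split; [| split; [lra |]].
  { apply Rmult_le_pos; [lra | apply Rmult_le_pos; [exact HK | apply Rabs_pos]]. }
  intros h Hh.
  assert (Hzh : 0 < Im (z + h)%C).
  { pose proof (im_le_Cmod h) as Hi; unfold y in *; destruct z, h; unfold Im in *; simpl in *.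
    pose proof (Rle_abs (- r2)); rewrite Rabs_Ropp in *; lra. }
  set (e := fun k => (RtoC (c k) * (qpow (Z.of_nat k - Z.of_nat M) (z + h) - qpow (Z.of_nat k - Z.of_nat M) z
     - imag (2 * PI * IZR (Z.of_nat k - Z.of_nat M)) * qpow (Z.of_nat k - Z.of_nat M) z * h))%C).
  set (cj := fun k => c k * IZR (Z.of_nat k - Z.of_nat M)) in *.
  assert (He : (qser c M (z + h) - qser c M z - imag (2 * PI) * qser cj M z * h)%C = CSeries e).
  { transitivity (qser c M (z + h)
      + (- RtoC 1 * qser c M z + (- (imag (2 * PI) * h)) * qser cj M z))%C;
      [ring |].
    unfold qser; rewrite <- !CSeries_scal by auto.
    rewrite <- !CSeries_plus by auto using csummable_plus, csummable_scal.
    apply CSeries_ext; intros k; unfold qterm, e, cj.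
    replace (imag (2 * PI * IZR (Z.of_nat k - Z.of_nat M)))
      with (imag (2 * PI) * RtoC (IZR (Z.of_nat k - Z.of_nat M)))%C
      by (unfold imag, RtoC, Cmult; simpl; f_equal; ring).
    rewrite RtoC_mult; ring. }
  rewrite He.
  eapply Rle_trans; [apply (Cmod_CSeries e (fun k => K * (Cmod h * Cmod h) * b k)) |].
  - intros k; unfold e, b; rewrite Cmod_mult, Cmod_R, Cmod_qterm.
    change (Im (0, y / 2)) with (y / 2).
    pose proof (qterm_index_bound M k y Hz) as Hb.
    pose proof (qpow_quadratic (Z.of_nat k - Z.of_nat M) z h) as Hq; fold y in Hq.
    set (j := IZR (Z.of_nat k - Z.of_nat M)) in *.
    pose proof (Cmod_ge_0 h) as Hh0; pose proof (Rabs_pos j) as Hj.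
    replace (K * (Cmod h * Cmod h) * (Rabs (c k) * exp (- (2 * PI * j) * (y / 2))))
      with (Rabs (c k) * (K * (Cmod h * Cmod h) * exp (- (2 * PI * j) * (y / 2)))) by ring.
    apply Rmult_le_compat_l; [apply Rabs_pos |].
    eapply Rle_trans; [exact Hq |].
    replace (- (2 * PI * j) * (y / 2)) with (- (2 * PI * j) * y + PI * j * y) by field.
    rewrite exp_plus.
    set (s := 2 * PI * Rabs j * (y / 4)).
    assert (Hj2 : 0 <= 2 * PI * Rabs j) by (apply Rmult_le_pos; lra).
    assert (Hs0 : 0 <= s) by (apply Rmult_le_pos; lra).
    pose proof (exp_ge_square s Hs0) as Hsq.
    assert (Hexp : exp (2 * PI * Rabs j * Cmod h) <= exp s).
    { destruct (Rle_lt_or_eq_dec (2 * PI * Rabs j * Cmod h) s) as [Hlt | ->];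
        [| now left; apply exp_increasing | lra].
      unfold s; apply Rmult_le_compat_l; lra. }
    assert (Hss : exp s * exp s = exp (PI * Rabs j * y))
      by (rewrite <- exp_plus; f_equal; unfold s; field).
    replace (K * (Cmod h * Cmod h) * (exp (- (2 * PI * j) * y) * exp (PI * j * y)))
      with (exp (- (2 * PI * j) * y) * (512 / (y * y) * (Cmod h * Cmod h) *
              (exp (2 * PI * INR M * y) * exp (PI * j * y)))) by (unfold K; ring).
    apply Rmult_le_compat_l; [left; apply exp_pos |].
    apply Rle_trans with (512 / (y * y) * (Cmod h * Cmod h) * (exp s * exp s)).
    + replace (8 * (2 * PI * Rabs j * Cmod h * (2 * PI * Rabs j * Cmod h)))
        with (128 / (y * y) * (Cmod h * Cmod h) * (s * s)) by (unfold s; field; lra).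
      replace (512 / (y * y) * (Cmod h * Cmod h) * (exp s * exp s))
        with (128 / (y * y) * (Cmod h * Cmod h) * (4 * exp s) * exp s) by (field; lra).
      assert (Hc0 : 0 <= 128 / (y * y) * (Cmod h * Cmod h)).
      { apply Rmult_le_pos; [left; apply Rdiv_lt_0_compat |]; nra. }
      apply Rmult_le_compat; try (left; apply exp_pos); auto.
      * apply Rmult_le_pos; nra.
      * now apply Rmult_le_compat_l.
    + rewrite Hss; apply Rmult_le_compat_l; [| exact Hb].
      apply Rmult_le_pos; [left; apply Rdiv_lt_0_compat |]; nra.
  - apply (ex_series_scal (V := R_NormedModule) _ b), Hs.
  - rewrite Series_scal_l.
    replace (2 * (K * Rabs (Series b)) * (Cmod h * Cmod h))
      with (2 * (K * (Cmod h * Cmod h) * Rabs (Series b))) by ring.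
    apply Rmult_le_compat_l; [lra |]; apply Rmult_le_compat_l; [| apply Rle_abs].
    apply Rmult_le_pos; [exact HK | apply Rmult_le_pos; apply Cmod_ge_0].
Qed.

Lemma qsummable_dominated (c d : nat -> R) (M : nat) :
  (forall k, Rabs (d k) <= Rabs (c k)) -> qsummable c M -> qsummable d M.
Proof.
  intros H Hc z Hz; apply csummable_dominated with (fun k => Cmod (qterm c M z k)) 1.
  - intros k; rewrite !Cmod_qterm, Rmult_1_l.
    apply Rmult_le_compat_r; [left; apply exp_pos | apply H].
  - now apply Hc.
Qed.

(** The constant term integrates to [c M] times z, every other term to itself divided by 2 pi i (k -
    M). The latter are periodic, so the increment of [P] over a period comes from the linear
    summand. *)
Lemma qser_primitive (c : nat -> R) (M : nat) : qsummable c M ->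
  exists P : C -> C, (forall z, 0 < Im z -> cderiv P z (qser c M z)) /\
    forall z, P (z + RtoC 1)%C = (P z + RtoC (c M))%C.
Proof.
  intros Hc.
  set (c' := fun k => if Nat.eqb k M then 0 else c k).
  (* At k = M this divides by 0, but [c' M] is 0, so the quotient is 0 as well. *)
  set (d := fun k => c' k / IZR (Z.of_nat k - Z.of_nat M)).
  assert (Hc' : qsummable c' M).
  { apply qsummable_dominated with c; [| exact Hc]; intros k; unfold c'.
    destruct (Nat.eqb k M); [rewrite Rabs_R0; apply Rabs_pos | lra]. }
  assert (Hd : qsummable d M).
  { apply qsummable_dominated with c'; [| exact Hc']; intros k; unfold d, c'.
    destruct (Nat.eqb_spec k M) as [-> | Hk]; unfold Rdiv; [rewrite Rmult_0_l; lra |].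
    rewrite Rabs_mult; rewrite <- (Rmult_1_r (Rabs (c k))) at 2.
    apply Rmult_le_compat; try apply Rabs_pos; [lra |].
    rewrite Rabs_inv, <- abs_IZR, <- Rinv_1.
    apply Rinv_le_contravar; [lra | apply IZR_le; lia]. }
  assert (Hsplit : forall z, 0 < Im z -> qser c M z = (RtoC (c M) + qser c' M z)%C).
  { intros z Hz; destruct (CSeries_single M (RtoC (c M))) as [Hs Hv].
    rewrite <- Hv at 1; unfold qser; rewrite <- CSeries_plus by auto.
    apply CSeries_ext; intros k; unfold qterm, c'.
    destruct (Nat.eqb_spec k M) as [-> | Hk]; [rewrite Z.sub_diag, qpow_0 |]; ring. }
  exists (fun z => RtoC (c M) * z + imag (- / (2 * PI)) * qser d M z)%C; split.
  - intros z Hz.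
    refine (cderiv_eq _ _ _ _ _ (cderiv_plus _ _ _ _ _ (cderiv_linear (RtoC (c M)) z)
      (cderiv_comp (fun w => imag (- / (2 * PI)) * w)%C _ _ _ _ (qser_cderiv d M z Hd Hz)
         (cderiv_linear _ _)))).
    rewrite Hsplit by assumption; f_equal.
    transitivity (qser (fun k => d k * IZR (Z.of_nat k - Z.of_nat M)) M z).
    + rewrite Cmult_assoc.
      replace (imag (- / (2 * PI)) * imag (2 * PI))%C with (RtoC 1); [ring |].
      pose proof PI_RGT_0; unfold imag, RtoC, Cmult; simpl; f_equal; field; lra.
    + apply CSeries_ext; intros k; unfold qterm, d; do 2 f_equal; unfold c'.
      destruct (Nat.eqb_spec k M) as [-> | Hk]; [unfold Rdiv; ring |].
      field; apply not_0_IZR; lia.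
  - intros z.
    replace (qser d M (z + RtoC 1)%C) with (qser d M z); [ring |].
    apply CSeries_ext; intros k; unfold qterm; now rewrite qpow_period.
Qed.

Definition cauchy_prod (a b : nat -> R) (n : nat) : R := sum_f_R0 (fun k => a k * b (n - k)%nat) n.

Lemma qser_mult (a b : nat -> R) (m n : nat) : qsummable a m -> qsummable b n ->
  qsummable (cauchy_prod a b) (m + n) /\
  forall z, 0 < Im z -> qser (cauchy_prod a b) (m + n) z = (qser a m z * qser b n z)%C.
Proof.
  intros Ha Hb.
  assert (Hterm : forall z k,
    csum (fun i => qterm a m z i * qterm b n z (k - i)%nat)%C k = qterm (cauchy_prod a b) (m + n) z k).
  { intros z k; unfold qterm at 3, cauchy_prod; rewrite <- csum_RtoC_scal.
    apply csum_ext; intros i Hi; unfold qterm.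
    replace (Z.of_nat k - Z.of_nat (m + n))%Z
      with ((Z.of_nat i - Z.of_nat m) + (Z.of_nat (k - i) - Z.of_nat n))%Z by lia.
    rewrite qpow_add, RtoC_mult; ring. }
  split.
  - intros z Hz; destruct (CSeries_mult _ _ (Ha z Hz) (Hb z Hz)) as [Hs _].
    eapply ex_series_ext; [| exact Hs]; intros k; simpl; now rewrite Hterm.
  - intros z Hz; destruct (CSeries_mult _ _ (Ha z Hz) (Hb z Hz)) as [_ Hv].
    unfold qser; rewrite <- Hv; apply CSeries_ext; intros k; now rewrite Hterm.
Qed.

Lemma qexp_int_qser (f : C -> C) (a : Z -> Z) : qexp_int f a ->
  exists n : nat, (forall j, (j < - Z.of_nat n)%Z -> a j = 0%Z) /\
    let c := fun k => IZR (a (Z.of_nat k - Z.of_nat n)%Z) in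
    qsummable c n /\ forall z, 0 < Im z -> qser c n z = f z.
Proof.
  intros (n & Hn & Hs); exists n; split; [exact Hn |]; split.
  - apply qsummable_of_is_series; intros z Hz; exists (f z); exact (Hs z Hz).
  - intros z Hz; apply CSeries_is_series; exact (Hs z Hz).
Qed.

(** * Moebius transformations *)

Lemma IZR_gdet (g : SL2Z) : IZR (ga g) * IZR (gd g) - IZR (gb g) * IZR (gc g) = 1.
Proof. rewrite <- !mult_IZR, <- minus_IZR, gdet; reflexivity. Qed.

Lemma autf_neq_0 (g : SL2Z) (z : C) : 0 < Im z -> autf g z <> RtoC 0.
Proof.
  intros Hz H; destruct z as [x y]; unfold autf, RtoC, Cmult, Cplus, Im in *; simpl in *.
  injection H; intros Hi Hr.
  assert (Hc : IZR (gc g) = 0) by (apply Rmult_eq_reg_r with y; lra).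
  pose proof (IZR_gdet g); rewrite Hc in *; nra.
Qed.

Lemma Im_mob_pos (g : SL2Z) (z : C) : 0 < Im z -> 0 < Im (mob g z).
Proof.
  intros Hz; pose proof (autf_neq_0 g z Hz) as Ha; pose proof (IZR_gdet g) as Hdet.
  apply Cmod_gt_0 in Ha; pose proof (Cmod2_alt (autf g z)) as Hmod.
  unfold mob; set (w := autf g z) in *.
  assert (Hw : 0 < Re w ^ 2 + Im w ^ 2) by (rewrite <- Hmod; nra).
  replace (Im _) with (Im z / (Re w ^ 2 + Im w ^ 2)); [now apply Rdiv_lt_0_compat |].
  rewrite <- (Rmult_1_r (Im z)), <- Hdet.
  unfold w, autf in *; destruct z as [x y]; unfold Re, Im, RtoC, Cdiv, Cinv, Cmult, Cplus in *; simpl in *.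
  field; lra.
Qed.

Lemma mob_ext (g h : SL2Z) (z : C) :
  ga g = ga h -> gb g = gb h -> gc g = gc h -> gd g = gd h -> mob g z = mob h z.
Proof. intros Ha Hb Hc Hd; unfold mob, autf; now rewrite Ha, Hb, Hc, Hd. Qed.

Lemma SL2mul_det (g h : SL2Z) :
  ((ga g * ga h + gb g * gc h) * (gc g * gb h + gd g * gd h)
   - (ga g * gb h + gb g * gd h) * (gc g * ga h + gd g * gc h) = 1)%Z.
Proof.
  replace 1%Z with ((ga g * gd g - gb g * gc g) * (ga h * gd h - gb h * gc h))%Z
    by (rewrite !gdet; reflexivity).
  ring.
Qed.

Definition SL2mul (g h : SL2Z) : SL2Z :=
  mkSL2Z (ga g * ga h + gb g * gc h) (ga g * gb h + gb g * gd h)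
         (gc g * ga h + gd g * gc h) (gc g * gb h + gd g * gd h) (SL2mul_det g h).

Lemma SL2inv_det (g : SL2Z) : (gd g * ga g - (- gb g) * (- gc g) = 1)%Z.
Proof. rewrite <- (gdet g); ring. Qed.

Definition SL2inv (g : SL2Z) : SL2Z := mkSL2Z (gd g) (- gb g) (- gc g) (ga g) (SL2inv_det g).

Lemma mob_mul (g h : SL2Z) (z : C) : 0 < Im z -> mob (SL2mul g h) z = mob g (mob h z).
Proof.
  intros Hz.
  pose proof (autf_neq_0 h z Hz) as Hh.
  pose proof (autf_neq_0 g _ (Im_mob_pos h z Hz)) as Hg.
  pose proof (autf_neq_0 (SL2mul g h) z Hz) as Hgh.
  unfold mob, autf, SL2mul in *; simpl in *.
  rewrite !plus_IZR, !mult_IZR, !RtoC_plus, !RtoC_mult in *.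
  field; repeat split; try assumption.
  intros H; apply Hgh; rewrite <- H; ring.
Qed.

(** With w = cz + d the remainder is exactly - c h^2 / ((w + ch) w^2), by the determinant relation.
    The radius gives |ch| <= |w|/2, hence |w + ch| >= |w|/2. *)
Lemma mob_cderiv (g : SL2Z) (z : C) : 0 < Im z ->
  cderiv (mob g) z (/ (autf g z * autf g z))%C.
Proof.
  intros Hz; pose proof (autf_neq_0 g z Hz) as Ha; set (w := autf g z) in *.
  pose proof (proj1 (Cmod_gt_0 _) Ha) as Hw.
  set (c := RtoC (IZR (gc g))). pose proof (Cmod_ge_0 c) as Hc.
  assert (Hd : 0 < Cmod w / (2 * (Cmod c + 1))) by (apply Rdiv_lt_0_compat; lra).
  exists (Cmod c * (2 / (Cmod w * (Cmod w * Cmod w)))), (Cmod w / (2 * (Cmod c + 1))).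
  split; [| split; [exact Hd |]].
  { apply Rmult_le_pos; [exact Hc |]; left; apply Rdiv_lt_0_compat; [lra |].
    repeat apply Rmult_lt_0_compat; lra. }
  intros h Hh; pose proof (Cmod_ge_0 h) as Hh0.
  assert (Hch : Cmod (c * h)%C <= Cmod w / 2).
  { apply Rmult_lt_compat_r with (r := Cmod c + 1) in Hh; [| lra].
    replace (Cmod w / (2 * (Cmod c + 1)) * (Cmod c + 1)) with (Cmod w / 2) in Hh by (field; lra).
    rewrite Cmod_mult; lra. }
  assert (Hw' : autf g (z + h)%C = (w + c * h)%C) by (unfold w, c, autf; ring).
  assert (Hlow : Cmod w / 2 <= Cmod (w + c * h)%C).
  { pose proof (Cmod_triangle (w + c * h)%C (- (c * h))%C) as Ht; rewrite Cmod_opp in Ht.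
    replace (w + c * h + - (c * h))%C with w in Ht by ring; lra. }
  assert (Hne : (w + c * h)%C <> RtoC 0) by (apply Cmod_gt_0; lra).
  replace (mob g (z + h) - mob g z - / (w * w) * h)%C
    with (- (c * (/ ((w + c * h) * (w * w)))) * (h * h))%C.
  - rewrite Cmod_mult, Cmod_opp, !Cmod_mult, Cmod_inv, !Cmod_mult
      by (repeat apply Cmult_neq_0; assumption).
    apply Rmult_le_compat_r; [nra |]; apply Rmult_le_compat_l; [exact Hc |].
    replace (2 / (Cmod w * (Cmod w * Cmod w))) with (/ ((Cmod w / 2) * (Cmod w * Cmod w)))
      by (field; lra).
    apply Rinv_le_contravar; [repeat apply Rmult_lt_0_compat; lra |].
    apply Rmult_le_compat_r; [nra | exact Hlow].
  - unfold mob; rewrite Hw'; fold w.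
    assert (Hdet : (RtoC (IZR (ga g)) * RtoC (IZR (gd g)) - RtoC (IZR (gb g)) * c)%C = RtoC 1)
      by (unfold c; rewrite <- !RtoC_mult, <- RtoC_minus, IZR_gdet; reflexivity).
    assert (Hnum : ((RtoC (IZR (ga g)) * (z + h) + RtoC (IZR (gb g))) * w
      = (RtoC (IZR (ga g)) * z + RtoC (IZR (gb g))) * (w + c * h) + h)%C).
    { replace h with (RtoC 1 * h)%C at 3 by ring; rewrite <- Hdet; unfold w, autf; fold c; ring. }
    replace (RtoC (IZR (ga g)) * (z + h) + RtoC (IZR (gb g)))%C
      with (((RtoC (IZR (ga g)) * z + RtoC (IZR (gb g))) * (w + c * h) + h) / w)%C
      by (rewrite <- Hnum; field; assumption).
    field; split; assumption.
Qed.

(** The derivative (cz + d)^(-2) of g cancels the weight 2 factor of [G], so P(gz) - P(z) has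
    derivative 0. Its constant value is read off at i. *)
Lemma primitive_quasi_invariant (N : nat) (G P : C -> C) :
  modular 2 N G -> (forall z, 0 < Im z -> cderiv P z (G z)) ->
  forall g, inGamma0 N g -> exists c : C, forall z, 0 < Im z -> P (mob g z) = (P z + c)%C.
Proof.
  intros HG HP g Hg.
  assert (HD : forall z, 0 < Im z -> cderiv (fun w => P (mob g w) + - RtoC 1 * P w)%C z (RtoC 0)).
  { intros z Hz.
    refine (cderiv_eq _ _ _ _ _ (cderiv_plus _ _ _ _ _
      (cderiv_comp P _ _ _ _ (mob_cderiv g z Hz) (HP _ (Im_mob_pos g z Hz)))
      (cderiv_comp (fun w => - RtoC 1 * w)%C P _ _ _ (HP z Hz) (cderiv_linear _ _)))).
    rewrite HG by assumption; simpl.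
    field; now apply autf_neq_0. }
  exists (P (mob g Ci) + - RtoC 1 * P Ci)%C; intros z Hz.
  rewrite (constant_of_cderiv_0 _ HD z Ci Hz) by (unfold Im; simpl; lra).
  ring.
Qed.

(** * Cosets of Gamma_0(N) *)

Definition SL2_one : SL2Z := mkSL2Z 1 0 0 1 eq_refl.
Definition SL2_S : SL2Z := mkSL2Z 0 (-1) 1 0 eq_refl.
Definition SL2_ST : SL2Z := mkSL2Z 0 (-1) 1 1 eq_refl.

(** Tests whether g h^(-1) lies in Gamma_0(N). It is boolean so that coset tables can be checked by
    computation. *)
Definition same_coset (N : nat) (g h : SL2Z) : bool :=
  ((gc (SL2mul g (SL2inv h))) mod Z.of_nat N =? 0)%Z.

Fixpoint coset_index (N : nat) (l : list SL2Z) (g : SL2Z) : nat :=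
  match l with
  | [] => 0
  | h :: l' => if same_coset N g h then 0 else S (coset_index N l' g)
  end.

(* The junk index [length l] (no coset found) is excluded by counting. *)
Definition permutes_cosets (N : nat) (l : list SL2Z) (s : SL2Z) : bool :=
  let idx := map (fun g => coset_index N l (SL2mul g s)) l in
  forallb (fun i => existsb (Nat.eqb i) idx) (seq 0 (length l)).

(** Breadth-first search of the orbit of the trivial coset under right multiplication by S and ST,
    which generate SL_2(Z). Its output is certified afterwards by [coset_system]. *)
Fixpoint coset_search (N fuel : nat) (todo seen : list SL2Z) : list SL2Z :=
  match fuel, todo with
  | S fuel', g :: todo' =>
      if existsb (same_coset N g) seen then coset_search N fuel' todo' seen
      else coset_search N fuel' (todo' ++ [SL2mul g SL2_S; SL2mul g SL2_ST]) (seen ++ [g])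
  | _, _ => seen
  end.

(* The largest index occurring is 72 (level 36), and each coset uses at most two units of fuel. *)
Definition coset_reps (N : nat) : list SL2Z := coset_search N 200 [SL2_one] [].

(** The certificate for a computed list: S and ST permute its cosets, and the entries after the head
    have lower-left entry not divisible by N, which by [not_cusp_at_infty] keeps them away from the
    cusp infinity. *)
Definition coset_system (N : nat) (l : list SL2Z) : bool :=
  permutes_cosets N l SL2_S && permutes_cosets N l SL2_ST &&
  forallb (fun g => negb (gc g mod Z.of_nat N =? 0)%Z) (tl l).

Lemma same_coset_mob (N : nat) (g h : SL2Z) : N <> 0%nat -> same_coset N g h = true ->
  exists d, inGamma0 N d /\ forall z, 0 < Im z -> mob g z = mob d (mob h z).
Proof.
  intros HN H; exists (SL2mul g (SL2inv h)); split.
  - apply Z.mod_divide; [lia |]; now apply Z.eqb_eq.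
  - intros z Hz; rewrite <- mob_mul by assumption.
    pose proof (gdet h) as Hdet; destruct g as [a b c d Hg], h as [a' b' c' d' Hh]; simpl in *.
    apply mob_ext; simpl.
    + replace a with (a * (a' * d' - b' * c'))%Z at 1 by (rewrite Hdet; ring); ring.
    + replace b with (b * (a' * d' - b' * c'))%Z at 1 by (rewrite Hdet; ring); ring.
    + replace c with (c * (a' * d' - b' * c'))%Z at 1 by (rewrite Hdet; ring); ring.
    + replace d with (d * (a' * d' - b' * c'))%Z at 1 by (rewrite Hdet; ring); ring.
Qed.

Lemma coset_index_spec (N : nat) (l : list SL2Z) (g : SL2Z) :
  (coset_index N l g < length l)%nat ->
  same_coset N g (nth (coset_index N l g) l SL2_one) = true.
Proof.
  induction l as [| h l IH]; simpl; [lia |].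
  destruct (same_coset N g h) eqn:E; [auto |]; intros H; apply IH; lia.
Qed.

(** * The trace of a primitive over the cosets *)

Definition Csum_list (l : list C) : C := fold_right Cplus (RtoC 0) l.

Lemma Csum_list_Permutation (l l' : list C) : Permutation l l' -> Csum_list l = Csum_list l'.
Proof.
  intros H; induction H; simpl; [reflexivity | now rewrite IHPermutation | ring | congruence].
Qed.

Lemma map_nth_seq_length {A : Type} (d : A) (l : list A) :
  map (fun i => nth i l d) (seq 0 (length l)) = l.
Proof.
  induction l as [| a l IH]; simpl; [reflexivity |].
  f_equal; now rewrite <- seq_shift, map_map.
Qed.

Definition coset_trace (P : C -> C) (l : list SL2Z) (z : C) : C :=
  Csum_list (map (fun g => P (mob g z)) l).

(** Each product g s equals d g' with d in Gamma_0(N) and g' in the list, and g' runs through the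
    list as g does. Every summand is thus moved to another one up to an additive constant. *)
Lemma coset_trace_translate (N : nat) (l : list SL2Z) (s : SL2Z) (P : C -> C) : N <> 0%nat ->
  (forall g, inGamma0 N g -> exists c : C, forall z, 0 < Im z -> P (mob g z) = (P z + c)%C) ->
  permutes_cosets N l s = true ->
  exists c : C, forall z, 0 < Im z -> coset_trace P l (mob s z) = (coset_trace P l z + c)%C.
Proof.
  intros HN HP Hl.
  set (idx := fun g => coset_index N l (SL2mul g s)).
  (* The check says that every index occurs among the images. As there are only [length l] images,
     each occurs exactly once and the junk index is excluded. *)
  assert (Hperm : Permutation (seq 0 (length l)) (map idx l)).
  { apply NoDup_Permutation_bis.
    - apply seq_NoDup.
    - rewrite length_map, length_seq; lia.
    - intros i Hi. apply forallb_forall with (x := i) in Hl; [| exact Hi].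
      apply existsb_exists in Hl; destruct Hl as (j & Hj & E).
      apply Nat.eqb_eq in E; now subst j. }
  assert (Hidx : forall g, In g l -> (idx g < length l)%nat).
  { intros g Hg; apply in_map with (f := idx) in Hg.
    apply (Permutation_in _ (Permutation_sym Hperm)), in_seq in Hg; lia. }
  (* The induction runs over sublists [l0], while [idx] and [nth] keep referring to the full list
     [l]. *)
  assert (Hsum : forall l0, incl l0 l -> exists c : C, forall z, 0 < Im z ->
    coset_trace P l0 (mob s z)
    = (Csum_list (map (fun i => P (mob (nth i l SL2_one) z)) (map idx l0)) + c)%C).
  { induction l0 as [| g l0 IH]; intros Hincl.
    - exists (RtoC 0); intros; unfold coset_trace; simpl; ring.
    - destruct IH as (c & Hc); [intros x Hx; apply Hincl; now right |].
      destruct (same_coset_mob N _ _ HN (coset_index_spec N l (SL2mul g s)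
        (Hidx g (Hincl g (or_introl eq_refl))))) as (d & Hd & Hmob).
      destruct (HP d Hd) as (c' & Hc').
      exists (c' + c)%C; intros z Hz; unfold coset_trace in *; simpl.
      rewrite Hc, <- mob_mul, Hmob, Hc' by auto using Im_mob_pos.
      unfold idx; ring. }
  destruct (Hsum l (incl_refl l)) as (c & Hc); exists c; intros z Hz.
  rewrite Hc by assumption; f_equal.
  rewrite <- (Csum_list_Permutation _ _ (Permutation_map _ Hperm)).
  unfold coset_trace; now rewrite <- (map_map (fun i => nth i l SL2_one) (fun g => P (mob g z))),
    map_nth_seq_length.
Qed.

Lemma mob_S_fixed : mob SL2_S Ci = Ci.
Proof.
  unfold mob, autf, Ci, SL2_S, RtoC, Cdiv, Cinv, Cmult, Cplus; simpl; f_equal; field.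
Qed.

Definition rho : C := (- 1 / 2, sqrt 3 / 2).

Lemma mob_ST_fixed : mob SL2_ST rho = rho.
Proof.
  assert (Him : 0 < Im rho) by (unfold Im; simpl; pose proof (sqrt_lt_R0 3); lra).
  pose proof (autf_neq_0 SL2_ST rho Him) as Ha.
  (* [rho] is a primitive cube root of unity, so rho (rho + 1) = -1, the numerator of ST at
     [rho]. *)
  unfold mob; replace (RtoC (IZR (ga SL2_ST)) * rho + RtoC (IZR (gb SL2_ST)))%C
    with (rho * autf SL2_ST rho)%C; [field; assumption |].
  assert (H3 : sqrt 3 * sqrt 3 = 3) by (apply sqrt_sqrt; lra).
  unfold autf, rho, RtoC, Cmult, Cplus; simpl; f_equal; nra.
Qed.

Lemma mob_S_shift (z : C) : mob SL2_S (z + RtoC 1)%C = mob SL2_ST z.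
Proof. unfold mob, autf; simpl; f_equal; ring. Qed.

Lemma mob_one (z : C) : mob SL2_one z = z.
Proof. unfold mob, autf; simpl; field; intros H; injection H; lra. Qed.

Lemma Im_shift (z : C) : Im (z + RtoC 1)%C = Im z.
Proof. destruct z; unfold Im, RtoC; simpl; ring. Qed.

(* S and ST fix i and rho, so both additive constants vanish; and ST z = S (z + 1). *)
Lemma coset_trace_periodic (N : nat) (l : list SL2Z) (P : C -> C) : N <> 0%nat ->
  (forall g, inGamma0 N g -> exists c : C, forall z, 0 < Im z -> P (mob g z) = (P z + c)%C) ->
  permutes_cosets N l SL2_S = true -> permutes_cosets N l SL2_ST = true ->
  forall z, 0 < Im z -> coset_trace P l (z + RtoC 1)%C = coset_trace P l z.
Proof.
  intros HN HP HS HST.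
  assert (Hfix : forall s w, permutes_cosets N l s = true -> 0 < Im w -> mob s w = w ->
    forall z, 0 < Im z -> coset_trace P l (mob s z) = coset_trace P l z).
  { intros s w Hs Hw Hsw z Hz.
    destruct (coset_trace_translate N l s P HN HP Hs) as (c & Hc).
    assert (E : c = RtoC 0).
    { pose proof (Hc w Hw) as E; rewrite Hsw in E.
      replace c with (coset_trace P l w + c - coset_trace P l w)%C by ring.
      rewrite <- E; ring. }
    rewrite Hc, E by assumption; ring. }
  intros z Hz.
  rewrite <- (Hfix SL2_S Ci HS ltac:(unfold Im; simpl; lra) mob_S_fixed)
    by now rewrite Im_shift.
  rewrite mob_S_shift; apply (Hfix SL2_ST rho HST); [| exact mob_ST_fixed | exact Hz].
  unfold Im; simpl; pose proof (sqrt_lt_R0 3); lra.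
Qed.

(** * Vanishing of the period by comparison high in the half-plane *)

(** The limit is uniform in the real part. Positivity of [Im z] is a separate condition because [Y]
    may be negative. *)
Definition vanishes_at_ioo (f : C -> C) : Prop :=
  forall eps, 0 < eps -> exists Y, forall z, 0 < Im z -> Y < Im z -> Cmod (f z) < eps.

Lemma vanishes_plus (f g : C -> C) :
  vanishes_at_ioo f -> vanishes_at_ioo g -> vanishes_at_ioo (fun z => f z + g z)%C.
Proof.
  intros Hf Hg eps He.
  destruct (Hf (eps / 2)) as (Y & HY); [lra |].
  destruct (Hg (eps / 2)) as (Y' & HY'); [lra |].
  exists (Rmax Y Y'); intros z Hz HzY.
  pose proof (Rmax_l Y Y'); pose proof (Rmax_r Y Y').
  specialize (HY z Hz ltac:(lra)); specialize (HY' z Hz ltac:(lra)).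
  eapply Rle_lt_trans; [apply Cmod_triangle | lra].
Qed.

(** Periodicity of the full trace makes the increment of the tail equal to -c at every height, yet
    that increment tends to 0. *)
Lemma period_eq_0 (N : nat) (l : list SL2Z) (P : C -> C) (c : C) : N <> 0%nat ->
  permutes_cosets N (SL2_one :: l) SL2_S = true ->
  permutes_cosets N (SL2_one :: l) SL2_ST = true ->
  (forall g, inGamma0 N g -> exists c : C, forall z, 0 < Im z -> P (mob g z) = (P z + c)%C) ->
  (forall z, 0 < Im z -> P (z + RtoC 1)%C = (P z + c)%C) ->
  (forall g, In g l -> vanishes_at_ioo (fun z => P (mob g (z + RtoC 1)) - P (mob g z))%C) ->
  c = RtoC 0.
Proof.
  intros HN HS HST HP Hc Hv.
  assert (Htail : vanishes_at_ioo (fun z => coset_trace P l (z + RtoC 1) - coset_trace P l z)%C).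
  { clear HS HST; induction l as [| g l IH].
    - intros eps He; exists 0; intros z _ _; unfold coset_trace; simpl.
      replace (RtoC 0 - RtoC 0)%C with (RtoC 0) by ring; now rewrite Cmod_0.
    - pose proof (vanishes_plus _ _ (Hv g (or_introl eq_refl))
        (IH (fun g' H => Hv g' (or_intror H)))) as Hsum.
      intros eps He; destruct (Hsum eps He) as (Y & HY); exists Y; intros z Hz HzY.
      unfold coset_trace in *; simpl.
      eapply Rle_lt_trans; [| exact (HY z Hz HzY)]; right; f_equal; ring. }
  apply Cmod_eq_0, Rle_antisym; [| apply Cmod_ge_0].
  apply Rnot_lt_le; intros Hpos.
  destruct (Htail (Cmod c) Hpos) as (Y & HY).
  set (z := (0, Rmax Y 0 + 1) : C).
  pose proof (Rmax_l Y 0) as H1; pose proof (Rmax_r Y 0) as H2.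
  assert (Hz : 0 < Im z) by (unfold Im; simpl; lra).
  specialize (HY z Hz ltac:(unfold Im; simpl; lra)).
  pose proof (coset_trace_periodic N _ P HN HP HS HST z Hz) as E.
  unfold coset_trace in E, HY; simpl in E.
  rewrite !mob_one, Hc in E by assumption.
  fold (coset_trace P l z) in *; fold (coset_trace P l (z + RtoC 1)%C) in *.
  replace (coset_trace P l (z + RtoC 1) - coset_trace P l z)%C with (- c)%C in HY.
  - rewrite Cmod_opp in HY; lra.
  - transitivity ((P z + c + coset_trace P l (z + RtoC 1)) - c - P z - coset_trace P l z)%C;
      [rewrite E |]; ring.
Qed.

(** * The constant term of phi F *)

(** If d g is upper triangular with d in Gamma_0(N), then g itself has lower-left entry divisible by
    N: expand that entry using det d = 1; one summand vanishes and the other contains the lower-left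
    entry of d. *)
Lemma not_cusp_at_infty (N : nat) (g : SL2Z) : N <> 0%nat ->
  (gc g mod Z.of_nat N <> 0)%Z -> ~ cusp_at_infty N g.
Proof.
  intros HN Hg (d & [q Hq] & Hd); apply Hg, Z.mod_divide; [lia |].
  exists (q * (- ga d * ga g - gb d * gc g))%Z.
  pose proof (gdet d) as Hdet.
  transitivity ((ga d * gd d - gb d * gc d) * gc g)%Z; [rewrite Hdet; ring |].
  replace ((ga d * gd d - gb d * gc d) * gc g)%Z
    with (ga d * (gc d * ga g + gd d * gc g) + gc d * (- ga d * ga g - gb d * gc g))%Z by ring.
  rewrite Hd, Hq; ring.
Qed.

(** The weights 2 - k and k add up to 2, so this product is the derivative of P(gz) for a primitive
    P of f h. For a numeric k the integer powers unfold and [field] applies. *)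
Lemma slash_mult (k : Z) (f h : C -> C) (g : SL2Z) (z : C) : k = 2%Z \/ k = 4%Z -> 0 < Im z ->
  (slash (2 - k) f g z * slash k h g z
   = f (mob g z) * h (mob g z) * / (autf g z * autf g z))%C.
Proof.
  intros Hk Hz; pose proof (autf_neq_0 g z Hz).
  destruct Hk as [-> | ->]; unfold slash; simpl; field; assumption.
Qed.

Lemma modular_mult (k : Z) (N : nat) (f h : C -> C) : k = 2%Z \/ k = 4%Z ->
  modular (2 - k) N f -> modular k N h -> modular 2 N (fun z => f z * h z)%C.
Proof.
  intros Hk Hf Hh g Hg z Hz; pose proof (autf_neq_0 g z Hz).
  rewrite Hf, Hh by assumption.
  destruct Hk as [-> | ->]; simpl; field; assumption.
Qed.

(** On the horizontal segment from z to z + 1 the derivative of P(gz) is a bounded slash times one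
    tending to 0; the mean value inequality then bounds the increment. *)
Lemma primitive_vanishes (k : Z) (f h P : C -> C) (g : SL2Z) : k = 2%Z \/ k = 4%Z ->
  (forall z, 0 < Im z -> cderiv P z (f z * h z)%C) ->
  (exists M Y, forall z, Y < Im z -> Cmod (slash (2 - k) f g z) <= M) ->
  (forall eps, 0 < eps -> exists Y, forall z, Y < Im z -> Cmod (slash k h g z) < eps) ->
  vanishes_at_ioo (fun z => P (mob g (z + RtoC 1)) - P (mob g z))%C.
Proof.
  intros Hk HP (M & Y & Hf) Hh eps He.
  (* A positive bound whatever the sign of [M], so that division by it is allowed. *)
  set (B := Rmax M 0 + 1).
  pose proof (Rmax_l M 0) as HM; pose proof (Rmax_r M 0) as HM0.
  assert (HB : 0 < B) by (unfold B; lra).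
  (* The derivative is then at most eps/4, and the factor 2 of [mean_value_complex] leaves eps/2. *)
  destruct (Hh (eps / (4 * B))) as (Y' & HY'); [apply Rdiv_lt_0_compat; lra |].
  exists (Rmax Y Y'); intros z Hz HzY.
  pose proof (Rmax_l Y Y') as HYl; pose proof (Rmax_r Y Y') as HYr.
  apply Rle_lt_trans with (2 * (eps / 4)); [| lra].
  assert (Himt : forall t, Im (z + RtoC t * RtoC 1)%C = Im z)
    by (intros t; destruct z; unfold Im, RtoC; simpl; ring).
  apply (mean_value_complex (fun w => P (mob g w))
    (fun w => f (mob g w) * h (mob g w) * / (autf g w * autf g w))%C).
  - intros t _; apply (cderiv_comp P (mob g)).
    + apply mob_cderiv; now rewrite Himt.
    + apply HP, Im_mob_pos; now rewrite Himt.
  - intros t _; rewrite <- slash_mult with (k := k) by (try rewrite Himt; assumption).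
    rewrite !Cmod_mult, Cmod_1, Rmult_1_r.
    replace (eps / 4) with (B * (eps / (4 * B))) by (field; lra).
    apply Rmult_le_compat; try apply Cmod_ge_0.
    + eapply Rle_trans; [apply Hf; rewrite Himt |]; unfold B; lra.
    + left; apply HY'; rewrite Himt; lra.
Qed.

Lemma sum_single (f : nat -> R) (p n : nat) : (p <= n)%nat ->
  (forall i, (i <= n)%nat -> i <> p -> f i = 0) -> sum_f_R0 f n = f p.
Proof.
  intros Hp H; induction n as [| n IH]; simpl.
  - f_equal; lia.
  - destruct (Nat.eq_dec p (S n)) as [-> | Hne].
    + rewrite (sum_eq _ (fun _ => 0)) by (intros; apply H; lia).
      rewrite sum_cte; ring.
    + rewrite IH, (H (S n)) by (auto; lia); ring.
Qed.

Lemma sum_pair (f : nat -> R) (p q n : nat) : (p <= n)%nat -> (q <= n)%nat -> p <> q ->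
  (forall i, (i <= n)%nat -> i <> p -> i <> q -> f i = 0) -> sum_f_R0 f n = f p + f q.
Proof.
  intros Hp Hq Hpq H.
  rewrite (sum_eq f (fun i => (if Nat.eqb i p then f i else 0) + (if Nat.eqb i p then 0 else f i)))
    by (intros i _; destruct (Nat.eqb i p); ring).
  rewrite plus_sum, (sum_single _ p), (sum_single _ q); auto.
  - rewrite Nat.eqb_refl, (proj2 (Nat.eqb_neq q p)) by auto; reflexivity.
  - intros i Hi Hiq; destruct (Nat.eqb_spec i p); auto.
  - intros i Hi Hip; destruct (Nat.eqb_spec i p); congruence.
Qed.

(** Among the products A(j) C(-j), only two can be nonzero: j = -n gives C(n), since A(-n) = 1, and
    j = m gives -A(m), since C(-m) = -1. They are distinct because -n <= -2 < m. *)
Lemma constant_term_product (k n m : Z) (A Cf : Z -> Z) (r s : nat) :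
  k = 2%Z \/ k = 4%Z -> (2 <= n)%Z -> admissible k m -> phi_shape k n A -> F_shape m Cf ->
  (forall j, (j < - Z.of_nat r)%Z -> A j = 0%Z) ->
  (forall j, (j < - Z.of_nat s)%Z -> Cf j = 0%Z) ->
  cauchy_prod (fun i => IZR (A (Z.of_nat i - Z.of_nat r)%Z))
         (fun i => IZR (Cf (Z.of_nat i - Z.of_nat s)%Z)) (r + s) = IZR (Cf n - A m).
Proof.
  intros Hk Hn Hm [HAn HA] [HCm HC] HAr HCs.
  assert (Hm1 : (-1 <= m)%Z)
    by (unfold admissible in Hm; destruct Hk as [-> | ->]; simpl in Hm; lia).
  assert (HA' : forall j, j <> (- n)%Z -> (j < -1)%Z -> A j = 0%Z).
  { intros j Hj Hlt; apply HA; [exact Hj |]; destruct Hk as [-> | ->]; simpl; lia. }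
  (* The nonzero leading coefficients force n <= r and m <= s, so both surviving indices r - n and r
     + m lie between 0 and r + s. *)
  assert (Hrn : (n <= Z.of_nat r)%Z).
  { destruct (Z_le_gt_dec n (Z.of_nat r)) as [|Hgt]; [assumption |].
    rewrite HAr in HAn by lia; discriminate. }
  assert (Hsm : (m <= Z.of_nat s)%Z).
  { destruct (Z_le_gt_dec m (Z.of_nat s)) as [|Hgt]; [assumption |].
    rewrite HCs in HCm by lia; discriminate. }
  unfold cauchy_prod; rewrite (sum_pair _ (Z.to_nat (Z.of_nat r - n)) (Z.to_nat (Z.of_nat r + m)));
    [| lia | lia | lia |].
  2: { intros i Hi Hin Him.
    replace (Z.of_nat (r + s - i) - Z.of_nat s)%Z with (- (Z.of_nat i - Z.of_nat r))%Z by lia.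
    (* For j < -1 the gap in the expansion of phi applies; for j >= -1 the opposite exponent is at
       most 1 and the gap in that of F applies. *)
    destruct (Z_lt_le_dec (Z.of_nat i - Z.of_nat r) (-1)) as [Hj | Hj];
      [rewrite HA' by lia | rewrite HC by lia]; simpl; ring. }
  replace (Z.of_nat (Z.to_nat (Z.of_nat r - n)) - Z.of_nat r)%Z with (- n)%Z by lia.
  replace (Z.of_nat (r + s - Z.to_nat (Z.of_nat r - n)) - Z.of_nat s)%Z with n by lia.
  replace (Z.of_nat (Z.to_nat (Z.of_nat r + m)) - Z.of_nat r)%Z with m by lia.
  replace (Z.of_nat (r + s - Z.to_nat (Z.of_nat r + m)) - Z.of_nat s)%Z with (- m)%Z by lia.
  rewrite HAn, HCm, minus_IZR; ring.
Qed.

(** The level enters through the computed certificate alone; the increment of the primitive of phi F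
    over a period is C(n) - A(m), which [period_eq_0] shows to be 0. *)
Lemma duality_of_coset_system (k : Z) (N : nat) (l : list SL2Z) :
  k = 2%Z \/ k = 4%Z -> N <> 0%nat -> coset_system N (SL2_one :: l) = true ->
  forall (n m : Z) (phi F : C -> C) (A Cf : Z -> Z),
    (2 <= n)%Z -> admissible k m ->
    wh_form_Z (2 - k) N phi A -> phi_shape k n A ->
    wh_cusp_form_Z k N F Cf -> F_shape m Cf -> Cf n = A m.
Proof.
  intros Hk HN Hl n m phi F A Cf Hn Hm (Hqp & Hmp & Hcp) HA (HqF & HmF & HcF) HC.
  apply andb_prop in Hl; destruct Hl as [Hl Htl]; apply andb_prop in Hl; destruct Hl as [HS HST].
  destruct (qexp_int_qser _ _ Hqp) as (r & Hr & Hsr & Hvr).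
  destruct (qexp_int_qser _ _ HqF) as (s & Hs & Hss & Hvs).
  destruct (qser_mult _ _ _ _ Hsr Hss) as [Hsum Hprod].
  destruct (qser_primitive _ _ Hsum) as (P & HP & Hper).
  rewrite (constant_term_product k n m) in Hper by assumption.
  assert (HP' : forall z, 0 < Im z -> cderiv P z (phi z * F z)%C).
  { intros z Hz; rewrite <- Hvr, <- Hvs, <- Hprod by assumption; now apply HP. }
  assert (H0 : RtoC (IZR (Cf n - A m)) = RtoC 0).
  { apply (period_eq_0 N l P); auto.
    - exact (primitive_quasi_invariant N _ P (modular_mult k N _ _ Hk Hmp HmF) HP').
    - intros g Hg.
      assert (Hg' : ~ cusp_at_infty N g).
      { apply not_cusp_at_infty; [exact HN |].
        simpl in Htl; apply forallb_forall with (x := g) in Htl; [| exact Hg].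
        apply Z.eqb_neq; now destruct (_ =? _)%Z. }
      apply (primitive_vanishes k phi F); auto. }
  apply RtoC_inj, eq_IZR in H0; lia.
Qed.

Theorem theorem1p2 :
  forall (k : Z) (N : nat),
    ((k, N) = (2%Z, 27%nat) \/ (k, N) = (2%Z, 32%nat) \/ (k, N) = (2%Z, 36%nat)
     \/ (k, N) = (2%Z, 49%nat) \/ (k, N) = (4%Z, 9%nat)) ->
  forall (n m : Z) (phi F : C -> C) (A Cf : Z -> Z),
    (2 <= n)%Z ->
    admissible k m ->
    wh_form_Z (2 - k)%Z N phi A -> phi_shape k n A ->
    wh_cusp_form_Z k N F Cf -> F_shape m Cf ->
    Cf n = A m.
Proof.
  intros k N HkN.
  (* The search starts from the identity, so replacing the head of the computed list by [SL2_one]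
     only makes it explicit. The certificate is then evaluated at each of the five levels. *)
  assert (H : (k = 2%Z \/ k = 4%Z) /\ N <> 0%nat /\
    coset_system N (SL2_one :: tl (coset_reps N)) = true).
  { destruct HkN as [E | [E | [E | [E | E]]]]; injection E as -> ->;
      (split; [auto |]; split; [discriminate | vm_compute; reflexivity]). }
  destruct H as (Hk & HN & Hl).
  exact (duality_of_coset_system k N _ Hk HN Hl).
Qed.
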